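(* Let $\pi^{*}$ be a (nonnegative) Borel measure on $\mathbb{R}^d$ with $0<M:=\pi^{*}(\mathbb{R}^d)<\infty$, and let $\pi:=\pi^{*}/M$. Let $\alpha>1$ and let $\hat\pi$ be a probability distribution on $\mathbb{R}^d$ with $\pi\ll\hat\pi$. For any probability distribution $\eta$ on $\mathbb{R}^d$ such that $\pi\ll\eta$, $$\mathrm{KL}(\pi\mid\hat\pi)\le D_\alpha(\pi\mid\hat\pi)\le \mathrm{H}_\alpha(\hat\pi,\eta).$$
   Context: $\mu\ll\nu$ denotes absolute continuity. For $\pi\ll\xi$ and $\alpha>1$: $\mathrm{KL}(\pi\mid\xi)=\int\log\big(\frac{d\pi}{d\xi}\big)d\pi$ and $D_\alpha(\pi\mid\xi)=\frac1{\alpha-1}\log\int\big(\frac{d\pi}{d\xi}\big)^{\alpha-1}d\pi$, with values in $[0,\infty]$. $\mathsf{ELBO}(\eta)=\int\log\big(\frac{d\pi^{*}}{d\eta}\big)d\eta\in[-\infty,\infty)$ (with $\log0=-\infty$), and $\mathsf{CUBO}_\alpha(\xi)=(1-\alpha^{-1})D_\alpha(\pi\mid\xi)+\log M=\log\{\int(\frac{d\pi^{*}}{d\xi})^{\alpha}d\xi\}^{1/\alpha}\in(-\infty,\infty]$. $\mathrm{H}_\alpha(\xi,\eta)=\frac{\alpha}{\alpha-1}\{\mathsf{CUBO}_\alpha(\xi)-\mathsf{ELBO}(\eta)\}$. *)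

(* Defs.v *)
From HB Require Import structures.
From mathcomp Require Import all_boot all_order all_algebra.
From mathcomp Require Import all_classical all_reals all_analysis.

Set Implicit Arguments.
Unset Strict Implicit.
Unset Printing Implicit Defensive.

Import Order.TTheory GRing.Theory Num.Theory.
Import numFieldNormedType.Exports.

Local Open Scope classical_set_scope.
Local Open Scope ring_scope.
Local Open Scope ereal_scope.
Local Open Scope charge_scope.

(* R^d with its Borel sigma-algebra, generated by the open sets of the
   (product) topology of row vectors. *)
Notation borel_rV R d := (g_sigma_algebraType (@open 'rV[R]_d)).

Section divergences.
Context {disp : measure_display} {T : measurableType disp} {R : realType}.

(* The library's derivative is a version fixed by choice. It is unique, and
   nonnegative, only mu-almost everywhere; it is a density of nu w.r.t. mu as
   soon as nu `<< mu, and the constant -oo otherwise. *)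
Definition density (nu : {finite_measure set T -> \bar R})
    (mu : probability T R) : T -> \bar R :=
  'd (charge_of_finite_measure nu) '/d mu.

(* pi* / M with M = pi* setT. The second argument of mnormalize is a default
   value, returned only when the total mass is 0 or +oo. *)
Definition normalized (pistar : {finite_measure set T -> \bar R}) :
    probability T R :=
  mnormalize pistar point.

(* In the definitions below, lne 0 = -oo and lne +oo = +oo. *)

Definition KL (pi xi : probability T R) : \bar R :=
  \int[pi]_x lne (density pi xi x).

Definition renyi (alpha : R) (pi xi : probability T R) : \bar R :=
  ((alpha - 1)^-1)%:E *
  lne (\int[pi]_x (poweR (density pi xi x) (alpha - 1))).

Definition ELBO (pistar : {finite_measure set T -> \bar R})
    (eta : probability T R) : \bar R :=
  \int[eta]_x lne (density pistar eta x).

Definition CUBO (pistar : {finite_measure set T -> \bar R})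
    (alpha : R) (xi : probability T R) : \bar R :=
  lne (poweR (\int[xi]_x (poweR (density pistar xi x) alpha)) alpha^-1).

(* CUBO > -oo and ELBO < +oo for the measures considered, so that the
   difference is never of the form +oo - +oo or -oo - -oo. *)
Definition Hgap (pistar : {finite_measure set T -> \bar R})
    (alpha : R) (xi eta : probability T R) : \bar R :=
  (alpha / (alpha - 1))%:E * (CUBO pistar alpha xi - ELBO pistar eta).

End divergences.

(* Main.v *)
(* Both inequalities are Jensen's inequality for the logarithm. Write f for the
   density of pi with respect to pihat. Applied to f^(alpha-1) under pi, it gives
   KL <= D_alpha. Since dpi*/dpihat = M f, one has
   int (dpi*/dpihat)^alpha dpihat = M^alpha int f^(alpha-1) dpi, so that
   CUBO = (1 - 1/alpha) D_alpha + log M; applied to dpi*/deta under eta, Jensen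
   gives ELBO <= log M, whence the second inequality. *)

Require Import Defs.
From HB Require Import structures.
From mathcomp Require Import all_boot all_order all_algebra.
From mathcomp Require Import all_classical all_reals all_analysis.
From mathcomp Require Import measurable_realfun.
From mathcomp Require Import ring lra.

Import Order.TTheory GRing.Theory Num.Theory.
Import numFieldNormedType.Exports.

Local Open Scope classical_set_scope.
Local Open Scope ring_scope.
Local Open Scope ereal_scope.

(** * The extended logarithm and Jensen's inequality *)

Lemma measurable_lne (R : realType) : measurable_fun [set: \bar R] (@lne R).
Proof.
have -> : @lne R = fun x => if x <= 0 then -oo else
    if x == +oo then +oo else (ln (fine x))%:E.
  by apply/funext => -[r| |] //=; rewrite leNye.
apply: measurable_fun_ifT => //=; first exact: measurable_fun_lee.
apply: measurable_fun_ifT => //=; first exact: measurable_fun_eqe.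
apply/measurable_EFinP; exact: measurableT_comp.
Qed.

(** Concavity: for real [x > 0] this is [ln (1 + t) <= t] at [t = c^-1 * x - 1]. *)
Lemma lne_le_tangent (R : realType) (c : R) (x : \bar R) : (0 < c)%R ->
  lne x <= (ln c - 1)%:E + (c^-1)%:E * x.
Proof.
move=> c0; case: x => [r| |] /=; last 2 first.
- by rewrite gt0_muley ?lte_fin ?invr_gt0// addey// leey.
- by rewrite leNye.
case: ifPn => [_|]; first by rewrite leNye.
rewrite -ltNge => r0; rewrite -EFinM -EFinD lee_fin.
have rc0 : (0 < c^-1 * r)%R by rewrite mulr_gt0 ?invr_gt0.
have -> : r = (c * (c^-1 * r))%R by rewrite mulrA divff ?mul1r// gt_eqF.
rewrite lnM ?posrE// [(c^-1 * (c * _))%R]mulrA mulVf ?gt_eqF// mul1r.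
have /(@le_ln1Dx R) : (-1 < c^-1 * r - 1)%R by rewrite ltrBrDr addNr.
rewrite [(1 + _)%R]addrC subrK; lra.
Qed.

(** Integrability is not assumed, since the integral of a logarithm may be [-oo]: positive and
    negative parts are compared separately. *)
Lemma le_integral_measurable {d} {T : measurableType d} {R : realType}
    (mu : {measure set T -> \bar R}) (f g : T -> \bar R) :
  measurable_fun setT f -> measurable_fun setT g -> (forall x, f x <= g x) ->
  \int[mu]_x f x <= \int[mu]_x g x.
Proof.
move=> mf mg fg; rewrite integralE [leRHS]integralE leeB//.
- apply: ge0_le_integral => //; [exact: measurable_funepos..|].
  by move=> x _; apply: (@funepos_le _ _ setT); rewrite ?inE.
- apply: ge0_le_integral => //; [exact: measurable_funeneg..|].
  by move=> x _; apply: (@funeneg_le _ _ setT); rewrite ?inE.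
Qed.

(* Jensen's inequality: integrate the tangent line to the logarithm at the mean. *)
Lemma integral_le_lne {d} {T : measurableType d} {R : realType}
    (P : probability T R) (k : R) (h g : T -> \bar R) :
  (0 < k)%R -> measurable_fun setT h -> P.-integrable setT g ->
  0 < \int[P]_x g x -> (forall x, h x <= k%:E * lne (g x)) ->
  \int[P]_x h x <= k%:E * lne (\int[P]_x g x).
Proof.
move=> k0 mh ig; have fing := integrable_fin_num measurableT ig.
rewrite -(fineK fing) lte_fin; set c := fine _ => c0 hg.
have ia : P.-integrable setT (fun x => (ln c - 1)%:E + (c^-1)%:E * g x).
  apply: integrableD => //; last exact: integrableZl.
  exact: finite_measure_integrable_cst.
have ik : P.-integrable setT
    (fun x => k%:E * ((ln c - 1)%:E + (c^-1)%:E * g x)).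
  exact: integrableZl.
apply: (@le_trans _ _
    (\int[P]_x (k%:E * ((ln c - 1)%:E + (c^-1)%:E * g x)))).
  apply: le_integral_measurable => //; first exact: measurable_int ik.
  move=> x; apply: (le_trans (hg x)).
  by apply: lee_wpmul2l; [rewrite lee_fin ltW|exact: lne_le_tangent].
(* As [P] has mass 1 and [g] has mean [c], the tangent integrates to
   [(ln c - 1) + c^-1 * c = ln c]. *)
rewrite integralZl// integralD//; last 2 first.
- exact: finite_measure_integrable_cst.
- exact: integrableZl.
rewrite integral_cst// [X in _ * X + _](probability_setT P) mule1 integralZl//.
rewrite -(fineK fing) -/c.
by rewrite -EFinM mulVf ?gt_eqF// subrK lne_EFin.
Qed.

(** An equality for [x > 0]. A version of a density may take values [x <= 0], and there the left
    side is [-oo], whatever [poweR] returns. *)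
Lemma lne_le_poweR (R : realType) (a : R) (x : \bar R) : (0 < a)%R ->
  x \is a fin_num -> lne x <= (a^-1)%:E * lne (poweR x a).
Proof.
move=> a0; case: x => // r _ /=; case: ifPn; first by rewrite leNye.
rewrite -ltNge => r0; rewrite [(_ <= 0)%R]leNgt powR_gt0//= ln_powR -EFinM.
by rewrite mulrA mulVf ?gt_eqF// mul1r.
Qed.

(** * Powers of a Radon-Nikodym density *)

Section density.
Context {d : measure_display} {T : measurableType d} {R : realType}.
Variables (nu : {finite_measure set T -> \bar R}) (mu : probability T R).
Hypothesis numu : nu `<< mu.

(* Another version of the density, finite and nonnegative everywhere. *)
Local Notation g := (Radon_Nikodym_SigmaFinite.f nu mu).

Lemma measurable_density : measurable_fun setT (density nu mu).
Proof. exact/measurable_int/Radon_Nikodym_integrable. Qed.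

Lemma measurable_nneg_density : measurable_fun setT g.
Proof. exact/measurable_int/Radon_Nikodym_SigmaFinite.f_integrable. Qed.

Lemma ae_eq_nneg_density : ae_eq mu setT (density nu mu) g.
Proof. exact/ae_eq_sym/ae_eq_Radon_Nikodym_SigmaFinite. Qed.

Lemma integral_density : \int[mu]_x density nu mu x = nu setT.
Proof. by rewrite /density -Radon_Nikodym_integral. Qed.

(** Change of variables [dnu = g dmu]: the extra factor [g] raises the exponent by one. *)
Lemma integral_poweR_density (a : R) : (0 < a)%R ->
  \int[nu]_x poweR (density nu mu x) a = \int[mu]_x poweR (g x) (a + 1).
Proof.
move=> a0.
have mp : measurable_fun setT (fun x => poweR (g x) a).
  exact: (measurableT_comp (measurable_poweR a) measurable_nneg_density).
transitivity (\int[nu]_x poweR (g x) a).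
  apply: ae_eq_integral => //.
    exact: (measurableT_comp (measurable_poweR a) measurable_density).
  (* The two versions agree [mu]-almost everywhere, hence [nu]-almost everywhere by domination. *)
  apply: (null_dominates_ae_eq _ numu) => //.
  by apply: filterS ae_eq_nneg_density => x + _ => ->.
rewrite -(Radon_Nikodym_SigmaFinite.change_of_variables numu)//; last first.
  by move=> x; exact: poweR_ge0.
apply: eq_integral => x _; have g0 := Radon_Nikodym_SigmaFinite.f_ge0 numu x.
by rewrite poweRD ?poweRe1// add_neq0_poweRD_def// gt_eqF// addr_gt0.
Qed.

(** If the integral vanished, [g] would be zero almost everywhere, and so would the total mass
    [nu setT], which is the integral of [g]. *)
Lemma integral_poweR_density_gt0 (a : R) : (0 < a)%R -> 0 < nu setT ->
  0 < \int[mu]_x poweR (g x) a.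
Proof.
move=> a0 nu0; rewrite lt0e integral_ge0 ?andbT; last first.
  by move=> x _; exact: poweR_ge0.
apply/negP => /eqP Z0; move: nu0.
rewrite (Radon_Nikodym_SigmaFinite.f_integral numu)//.
rewrite (ae_eq_integral (cst 0)) ?integral0 ?ltxx//.
  exact: measurable_nneg_density.
have mp : measurable_fun setT (fun x => poweR (g x) a).
  exact: (measurableT_comp (measurable_poweR a) measurable_nneg_density).
have /ae_eq_integral_abs : \int[mu]_x `|poweR (g x) a| = 0.
  by under eq_integral do rewrite gee0_abs ?poweR_ge0//.
move=> /(_ measurableT mp); apply: filterS => x /(_ I) gx0 _.
apply: poweR_eq0_eq0 gx0; exact: Radon_Nikodym_SigmaFinite.f_ge0.
Qed.

End density.

(** * Passing between [pistar] and its normalization *)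

Section normalized.
Context {d : measure_display} {T : measurableType d} {R : realType}.
Variable pistar : {finite_measure set T -> \bar R}.
Hypothesis pistar_gt0 : 0 < pistar setT.

Local Notation M := (fine (pistar setT)).
Local Notation pi := (normalized pistar).

Lemma mass_gt0 : (0 < M)%R.
Proof. by rewrite fine_gt0// pistar_gt0 ltey_eq fin_num_measure. Qed.

Lemma normalizedE A : pistar A = M%:E * pi A.
Proof.
have M0 := mass_gt0.
rewrite /normalized /= /mnormalize ifF; last first.
  by rewrite gt_eqF//= lt_eqF// ltey_eq fin_num_measure.
by rewrite muleCA -EFinM divff ?mule1// gt_eqF.
Qed.

Variable mu : probability T R.
Hypothesis pimu : pi `<< mu.

Lemma dominates_normalized : pistar `<< mu.
Proof.
move/null_content_dominatesP: pimu => h; apply/null_content_dominatesP.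
by move=> A mA A0; rewrite normalizedE h// mule0.
Qed.

(** Both sides integrate to [pistar E] over every measurable [E], which determines a density almost
    everywhere. *)
Lemma ae_eq_density_normalized :
  ae_eq mu setT (density pistar mu) (fun x => M%:E * density pi mu x).
Proof.
have dom := dominates_normalized.
have ip : mu.-integrable setT (density pi mu) by exact: Radon_Nikodym_integrable.
apply: integral_ae_eq => //.
- exact: Radon_Nikodym_integrable.
- by apply: measurable_int; exact: (integrableZl measurableT M ip).
move=> E _ mE; rewrite integralZl//; last exact: integrableS ip.
rewrite /density -!Radon_Nikodym_integral//; exact: normalizedE.
Qed.

Lemma integral_poweR_normalized (a : R) : (0 < a)%R ->
  \int[mu]_x poweR (density pistar mu x) a =
  (M `^ a)%:E * \int[mu]_x poweR (Radon_Nikodym_SigmaFinite.f pi mu x) a.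
Proof.
move=> a0; have M0 := mass_gt0.
pose g := Radon_Nikodym_SigmaFinite.f pi mu.
have mg : measurable_fun setT (fun x => poweR (g x) a).
  exact: (measurableT_comp (measurable_poweR a) (measurable_nneg_density _ _ pimu)).
rewrite -ge0_integralZl//; last 2 first.
- by move=> x _; exact: poweR_ge0.
- by rewrite lee_fin powR_ge0.
apply: ae_eq_integral => //.
- apply: (measurableT_comp (measurable_poweR a)).
  exact: measurable_density dominates_normalized.
- exact: emeasurable_funM.
apply: filterS2 ae_eq_density_normalized (ae_eq_nneg_density _ _ pimu) => x + + _.
move=> /(_ I) -> /(_ I) ->; rewrite poweRM ?poweR_EFin//.
  by rewrite lee_fin ltW.
exact: Radon_Nikodym_SigmaFinite.f_ge0.
Qed.

(** Jensen's inequality with [k = 1]; the density has mean [M]. In the theorem [mu] is [eta] here,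
    and [pihat] in the lemmas on [renyi]. *)
Lemma ELBO_le_ln_mass : ELBO pistar mu <= (ln M)%:E.
Proof.
have M0 := mass_gt0; have dom := dominates_normalized.
have intE := integral_density _ _ dom.
have /= := @integral_le_lne _ _ _ mu 1%R (fun x => lne (density pistar mu x))
  (density pistar mu) ltr01.
rewrite intE mul1e -[pistar setT]fineK ?fin_num_measure// lne_EFin//.
apply => //.
- exact: (measurableT_comp (@measurable_lne R) (measurable_density _ _ dom)).
- exact: Radon_Nikodym_integrable.
- by move=> x; rewrite mul1e.
Qed.

(** * The two inequalities *)

Section divergences.
Variables (alpha : R) (alpha_gt1 : (1 < alpha)%R).

Let a1 : (0 < alpha - 1)%R. Proof. by rewrite subr_gt0. Qed.
Let a0 : (0 < alpha)%R. Proof. exact: lt_trans alpha_gt1. Qed.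

(** Expresses [renyi] through the integral that [integral_poweR_normalized] produces in [CUBO], so
    that the two can be compared. *)
Lemma renyiE : renyi alpha pi mu = ((alpha - 1)^-1)%:E *
  lne (\int[mu]_x poweR (Radon_Nikodym_SigmaFinite.f pi mu x) alpha).
Proof. by rewrite /renyi integral_poweR_density// subrK. Qed.

Lemma renyi_integral_gt0 :
  0 < \int[mu]_x poweR (Radon_Nikodym_SigmaFinite.f pi mu x) alpha.
Proof.
apply: integral_poweR_density_gt0 => //.
by rewrite [ltRHS](probability_setT pi).
Qed.

Lemma KL_le_renyi : KL pi mu <= renyi alpha pi mu.
Proof.
have mf := measurable_density _ _ pimu.
have mp := measurableT_comp (measurable_poweR (alpha - 1)) mf.
have Z0 : 0 < \int[pi]_x poweR (density pi mu x) (alpha - 1).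
  by rewrite integral_poweR_density// subrK renyi_integral_gt0.
rewrite /KL /renyi.
(* Jensen's inequality needs a finite mean; when the integral is [+oo], so is the Rényi
   divergence. *)
have [Zfin|] := boolP (\int[pi]_x poweR (density pi mu x) (alpha - 1) < +oo);
  last first.
  rewrite -leNgt leye_eq => /eqP -> /=.
  by rewrite gt0_muley ?leey// lte_fin invr_gt0.
apply: integral_le_lne => //.
- by rewrite invr_gt0.
- exact: (measurableT_comp (@measurable_lne R)).
- apply/integrableP; split => //.
  by under eq_integral do rewrite gee0_abs ?poweR_ge0//.
- by move=> x; apply: lne_le_poweR => //; exact: Radon_Nikodym_fin_num.
Qed.

Lemma renyi_le_Hgap (eta : probability T R) : ELBO pistar eta <= (ln M)%:E ->
  renyi alpha pi mu <= Hgap pistar alpha mu eta.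
Proof.
move=> elbo; have M0 := mass_gt0; have := renyi_integral_gt0.
rewrite renyiE /Hgap /CUBO integral_poweR_normalized//.
have c0 : (0 < alpha / (alpha - 1))%R by rewrite divr_gt0.
have Ma0 : (0 < M `^ alpha)%R by exact: powR_gt0.
case: (\int[mu]_x _) => [z| |//] => [|_]; last first.
  (* Infinite integral: [CUBO] is [+oo] and the ELBO is below [+oo], so the difference, and with it
     [Hgap], is [+oo]. *)
  rewrite [(M `^ alpha)%:E * _]gt0_muley ?lte_fin//.
  rewrite poweRyr ?gt_eqF ?invr_gt0//=.
  rewrite addye.
    by rewrite [leRHS]gt0_muley ?lte_fin// leey.
  by rewrite eqe_oppLR/= lt_eqF// (le_lt_trans elbo)// ltry.
rewrite lte_fin => z0; rewrite -EFinM poweR_EFin !lne_EFin ?powR_gt0 ?mulr_gt0//.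
(* Replacing the ELBO by its upper bound [ln M] can only decrease the gap. The factors [M] then
   cancel and leave [ln z / (alpha - 1)], the Rényi divergence. *)
apply: (@le_trans _ _ ((alpha / (alpha - 1))%:E *
  ((ln ((M `^ alpha * z) `^ alpha^-1))%:E - (ln M)%:E))); last first.
  by apply: lee_wpmul2l; [rewrite lee_fin ltW|exact: leeB].
rewrite -EFinB -!EFinM lee_fin ln_powR lnM ?posrE// ln_powR le_eqVlt.
apply/orP; left; apply/eqP; field.
by rewrite !gt_eqF.
Qed.

End divergences.
End normalized.

Theorem lemma4p5 (R : realType) (d : nat)
    (pistar : {finite_measure set (borel_rV R d) -> \bar R})
    (pistar_gt0 : 0 < pistar [set: borel_rV R d])
    (alpha : R) (alpha_gt1 : (1 < alpha)%R)
    (pihat : probability (borel_rV R d) R)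
    (pi_pihat : normalized pistar `<< pihat)
    (eta : probability (borel_rV R d) R)
    (pi_eta : normalized pistar `<< eta) :
  KL (normalized pistar) pihat <= renyi alpha (normalized pistar) pihat /\
  renyi alpha (normalized pistar) pihat <= Hgap pistar alpha pihat eta.
Proof.
split; first exact: KL_le_renyi.
by apply: renyi_le_Hgap => //; exact: ELBO_le_ln_mass.
Qed.
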